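(* Let $T$ be a complete first-order theory with monster model $\mathcal M$, and let $\boldsymbol e=a/E$, $\boldsymbol b=b_F$ and $\boldsymbol c=c_L$ be hyperimaginaries with $\boldsymbol c\in\operatorname{acl}(\boldsymbol b\boldsymbol e)$. Let $\boldsymbol c_0=\boldsymbol c,\dots,\boldsymbol c_{m-1}$ be all the distinct conjugates of $\boldsymbol c$ over $\boldsymbol b\boldsymbol e$, and suppose they are ordered so that $\boldsymbol b\boldsymbol c_0,\dots,\boldsymbol b\boldsymbol c_{m_0-1}$ ($1\le m_0\le m$) are representatives of all the distinct $\equiv^{\operatorname L}_{\boldsymbol e}$-classes among the realizations of $\overline p=\operatorname{tp}(\boldsymbol b\boldsymbol c/\boldsymbol e)$ with first coordinate $\boldsymbol b$. Let $p=\operatorname{tp}(\boldsymbol b/\boldsymbol e)$ and let $K_1$ be the kernel of the natural projection $\pi_1:\operatorname{Gal}^1_{\operatorname L}(\overline p)\to\operatorname{Gal}^1_{\operatorname L}(p)$. If $\operatorname{Gal}^1_{\operatorname L}(\overline p)$ is abelian, then $|K_1|=m_0$.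
   Context: Conventions: $\mathcal M$ is a ($\bar\kappa$-saturated) monster model of $T$; small means of cardinality $<\bar\kappa$; real tuples are sequences from $\mathcal M$ of small length. A hyperimaginary $b_F=b/F$ is the class of a real tuple $b$ modulo an $\emptyset$-type-definable equivalence relation $F$; small sequences of hyperimaginaries are treated as single hyperimaginaries. $E$ is an $\emptyset$-type-definable equivalence relation, $a$ a real tuple, $\boldsymbol e=a/E$. $\operatorname{Aut}_{\boldsymbol e}(\mathcal M)=\{f\in\operatorname{Aut}(\mathcal M): f(\boldsymbol e)=\boldsymbol e\}$; conjugates over $\boldsymbol b\boldsymbol e$ are images under automorphisms fixing $\boldsymbol b$ and $\boldsymbol e$, and $\boldsymbol c\in\operatorname{acl}(\boldsymbol b\boldsymbol e)$ means $\boldsymbol c$ has finitely many such conjugates. $\operatorname{Autf}_{\boldsymbol e}(\mathcal M)$ is the (normal) subgroup of $\operatorname{Aut}_{\boldsymbol e}(\mathcal M)$ generated by all $f\in\operatorname{Aut}_{\boldsymbol e}(\mathcal M)$ fixing pointwise some small model $M\prec\mathcal M$ with $\boldsymbol e\in\operatorname{dcl}(M)$ (i.e. $\boldsymbol e$ is fixed by all automorphisms fixing $M$ pointwise). $\boldsymbol u\equiv^{\operatorname L}_{\boldsymbol e}\boldsymbol v$ iff $f(\boldsymbol u)=\boldsymbol v$ for some $f\in\operatorname{Autf}_{\boldsymbol e}(\mathcal M)$. Relativized Lascar groups: for a hyperimaginary $\boldsymbol d$ and $q=\operatorname{tp}(\boldsymbol d/\boldsymbol e)$, the realizations of $q$ are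 the images of $\boldsymbol d$ under $\operatorname{Aut}_{\boldsymbol e}(\mathcal M)$ and $q(\mathcal M)$ is the set of realizations. $\operatorname{Aut}(q)=\{f\upharpoonright q(\mathcal M): f\in\operatorname{Aut}_{\boldsymbol e}(\mathcal M)\}$; $\operatorname{Autf}^1(q)$ is the (normal) subgroup of those $f\in\operatorname{Aut}(q)$ with $\boldsymbol d'\equiv^{\operatorname L}_{\boldsymbol e}f(\boldsymbol d')$ for every realization $\boldsymbol d'$ of $q$; $\operatorname{Gal}^1_{\operatorname L}(q)=\operatorname{Aut}(q)/\operatorname{Autf}^1(q)$. The natural projection is $\pi_1\bigl((f\upharpoonright\overline p(\mathcal M))\cdot\operatorname{Autf}^1(\overline p)\bigr)=(f\upharpoonright p(\mathcal M))\cdot\operatorname{Autf}^1(p)$ for $f\in\operatorname{Aut}_{\boldsymbol e}(\mathcal M)$, which is well defined. *)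

(* Defs.v *)
From HB Require Import structures.
From mathcomp Require Import all_boot.
From mathcomp Require Import boolp classical_sets functions cardinality.

Set Implicit Arguments.
Unset Strict Implicit.
Unset Printing Implicit Defensive.

Local Open Scope classical_set_scope.
Local Open Scope card_scope.
Local Open Scope quotient_scope.
Local Open Scope group_scope.

Section Groups.
Variable G : groupType.

Definition subgroup (A : set G) :=
  [/\ A 1, forall x y, A x -> A y -> A (x * y) & forall x, A x -> A x^-1].

Definition generated (A : set G) : set G := smallest subgroup A.

Record normalSubgroup := NormalSubgroup {
  nset : set G;
  nset_sub : subgroup nset;
  nset_norm : forall x g, nset x -> nset (x ^ g)
}.

Definition abelian_group := forall x y : G, x * y = y * x.

Lemma generated_subgroup A : subgroup (generated A).
Proof.
split=> [H [[]]//|x y Ax Ay H HA|x Ax H HA].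
  by have [[_ HM _] _] := HA; apply: HM; [exact: Ax|exact: Ay].
by have [[_ _ HV] _] := HA; apply: HV; exact: Ax.
Qed.

Lemma generatedP A : A `<=` generated A.
Proof. exact: sub_gen_smallest. Qed.

Lemma generated_min A H : subgroup H -> A `<=` H -> generated A `<=` H.
Proof. exact: smallest_sub. Qed.

End Groups.

(* The group G / N, whose elements are the (left) cosets of N. *)
Section Quotient.
Variables (G : groupType) (N : normalSubgroup G).

Definition coset_rel (x y : G) : bool := `[< nset N (x^-1 * y) >].

Lemma coset_rel_equiv : equiv_class_of coset_rel.
Proof.
have [N1 NM NV] := nset_sub N.
split=> [x|x y|y x z].
- by apply/asboolP; rewrite mulVg.
- by apply/asboolP/asboolP => /NV; rewrite invgM invgK.
- move=> /asboolP Nxy /asboolP Nyz; apply/asboolP.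
  by have := NM _ _ Nxy Nyz; rewrite mulgA mulgK.
Qed.

Canonical coset_equiv := EquivRelPack coset_rel_equiv.

Definition quot := {eq_quot coset_equiv}.
HB.instance Definition _ := Choice.on quot.
HB.instance Definition _ := EqQuotient.on quot.

Definition coset (x : G) : quot := \pi_quot x.

Lemma cosetP x y : coset x = coset y <-> nset N (x^-1 * y).
Proof.
split=> [/eqmodP/asboolP//|Nxy]; apply/eqmodP; exact/asboolP.
Qed.

Lemma coset_repr (x : quot) : coset (repr x) = x.
Proof. exact: reprK. Qed.

Definition quot_one : quot := coset 1.
Definition quot_mul (x y : quot) : quot := coset (repr x * repr y).
Definition quot_inv (x : quot) : quot := coset (repr x)^-1.

Lemma quot_mulE x y : quot_mul (coset x) (coset y) = coset (x * y).
Proof.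
have [N1 NM NV] := nset_sub N.
have /cosetP Nx := esym (coset_repr (coset x)).
have /cosetP Ny := esym (coset_repr (coset y)).
apply/esym/cosetP; rewrite invgM.
have := NM _ _ (nset_norm y Nx) Ny.
by rewrite /conjg -!mulgA mulVKg.
Qed.

Lemma quot_invE x : quot_inv (coset x) = coset x^-1.
Proof.
have [N1 NM NV] := nset_sub N.
have /cosetP/NV Nx := esym (coset_repr (coset x)).
apply/esym/cosetP; rewrite invgK.
move: Nx; rewrite invgM invgK => /(nset_norm x^-1).
by rewrite /conjg invgK -!mulgA mulgV mulg1.
Qed.

Lemma quot_mulA : associative quot_mul.
Proof.
by move=> x y z; rewrite -(coset_repr x) -(coset_repr y) -(coset_repr z)
  !quot_mulE mulgA.
Qed.
Lemma quot_mul1 : left_id quot_one quot_mul.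
Proof. by move=> x; rewrite -(coset_repr x) quot_mulE mul1g. Qed.
Lemma quot_mulr1 : right_id quot_one quot_mul.
Proof. by move=> x; rewrite -(coset_repr x) quot_mulE mulg1. Qed.
Lemma quot_mulV : left_inverse quot_one quot_inv quot_mul.
Proof. by move=> x; rewrite -(coset_repr x) quot_invE quot_mulE mulVg. Qed.
Lemma quot_mulrV : right_inverse quot_one quot_inv quot_mul.
Proof. by move=> x; rewrite -(coset_repr x) quot_invE quot_mulE mulgV. Qed.

HB.instance Definition _ := isGroup.Build quot
  quot_mulA quot_mul1 quot_mulr1 quot_mulV quot_mulrV.

Lemma cosetM x y : coset (x * y) = coset x * coset y.
Proof. by rewrite -quot_mulE. Qed.

Lemma coset1P x : coset x = 1 <-> nset N x.
Proof.
have [N1 NM NV] := nset_sub N.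
split=> [/esym/cosetP|Nx]; first by rewrite invg1 mul1g.
by apply/esym/cosetP; rewrite invg1 mul1g.
Qed.

End Quotient.

(* Formulas have free variables in an arbitrary type V; a quantifier binds the
   variable None of option V. *)
Record language := Language { func : nat -> Type; predic : nat -> Type }.

Inductive term (L : language) (V : Type) : Type :=
| Var of V
| App n of func L n & ('I_n -> term L V).

Inductive formula (L : language) (V : Type) : Type :=
| Bot
| Equ of term L V & term L V
| Rel n of predic L n & ('I_n -> term L V)
| Imp of formula L V & formula L V
| All of formula L (option V).

Record structure (L : language) := Structure {
  carrier :> Type;
  fint : forall n, func L n -> ('I_n -> carrier) -> carrier;
  rint : forall n, predic L n -> ('I_n -> carrier) -> Prop;
  carrier_inh : inhabited carrier
}.

Section Semantics.
Variables (L : language) (M : structure L).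

Fixpoint eval (V : Type) (v : V -> M) (t : term L V) : M :=
  match t with
  | Var x => v x
  | App n f ts => fint f (fun i => eval v (ts i))
  end.

Fixpoint sat (V : Type) (phi : formula L V) : (V -> M) -> Prop :=
  match phi with
  | Bot => fun v => False
  | Equ t u => fun v => eval v t = eval v u
  | Rel n r ts => fun v => rint r (fun i => eval v (ts i))
  | Imp phi psi => fun v => sat phi v -> sat psi v
  | All phi => fun v => forall x, sat phi (oapp v x)
  end.

End Semantics.

Section Renaming.
Variable L : language.

Fixpoint trename (V W : Type) (r : V -> W) (t : term L V) : term L W :=
  match t with
  | Var x => Var L (r x)
  | App n f ts => App f (fun i => trename r (ts i))
  end.

Fixpoint rename (V W : Type) (r : V -> W) (phi : formula L V) : formula L W :=
  match phi with
  | Bot => Bot L W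
  | Equ t u => Equ (trename r t) (trename r u)
  | Rel n p ts => Rel p (fun i => trename r (ts i))
  | Imp phi psi => Imp (rename r phi) (rename r psi)
  | All phi => All (rename (omap r) phi)
  end.

Lemma eval_rename (M : structure L) (V W : Type) (r : V -> W) (v : W -> M) t :
  eval v (trename r t) = eval (v \o r) t.
Proof.
elim: t => //= n f ts IH; congr fint; apply/funext => i; exact: IH.
Qed.

Lemma sat_rename (M : structure L) (V W : Type) (r : V -> W) (v : W -> M) phi :
  sat (rename r phi) v <-> sat phi (v \o r).
Proof.
elim: phi W r v => {V} [V|V t u|V n p ts|V phi IHp psi IHq|V phi IH] W r v //=.
- by rewrite !eval_rename.
- suff -> : (fun i => eval v (trename r (ts i))) =
            (fun i => eval (v \o r) (ts i)) by [].
  by apply/funext => i; rewrite eval_rename.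
- by rewrite IHp IHq.
- split=> H x; have := H x; rewrite IH;
    suff -> : oapp v x \o omap r = oapp (v \o r) x by [];
    by apply/funext; case.
Qed.

End Renaming.

Definition theory (L : language) := set (formula L void).

Definition holds L (M : structure L) (phi : formula L void) :=
  sat phi (of_void M).

Definition is_model L (T : theory L) (M : structure L) :=
  forall phi, T phi -> holds M phi.

Definition entails L (T : theory L) (phi : formula L void) :=
  forall M : structure L, is_model T M -> holds M phi.

Definition complete_theory L (T : theory L) :=
  (exists M : structure L, is_model T M) /\
  (forall phi, entails T phi \/ entails T (Imp phi (Bot L void))).

(* The cardinal of saturation is the cardinality of a type K: small means of
   cardinality < |K|. *)
Definition small (K X : Type) (A : set X) := ~ ([set: K] #<= A).

Section Substructures.
Variables (L : language) (M : structure L).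

Record is_substructure (N : set M) : Prop := IsSubstructure {
  sub_nonempty : inhabited {x | N x};
  sub_closed : forall n (f : func L n) (x : 'I_n -> {x | N x}),
    N (fint f (fun i => sval (x i)))
}.

Definition induced (N : set M) (hN : is_substructure N) : structure L :=
  @Structure L {x | N x}
    (fun n f x => exist _ _ (sub_closed hN f x))
    (fun n r x => rint r (fun i => sval (x i)))
    (sub_nonempty hN).

Definition elementary_substructure (N : set M) :=
  exists hN : is_substructure N,
    forall (V : Type) (phi : formula L V) (v : V -> {x | N x}),
      @sat L (induced hN) V phi v <-> @sat L M V phi (fun i => sval (v i)).

Definition partial_elementary (A : set M) (g : M -> M) :=
  forall (V : Type) (phi : formula L V) (v : V -> M), (forall i, A (v i)) ->
    sat phi v <-> sat phi (g \o v).

Definition is_aut (f : M -> M) :=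
  [/\ bijective f,
      forall n (s : func L n) (x : 'I_n -> M), f (fint s x) = fint s (f \o x) &
      forall n (r : predic L n) (x : 'I_n -> M), rint r (f \o x) <-> rint r x].

End Substructures.

Section Monster.
Variables (K : Type) (L : language) (M : structure L).

(* The variable None is the variable of the 1-type, Some a stands for the
   parameter a. *)
Definition saturated :=
  forall (A : set M) (p : set (formula L (option {x | A x}))),
    small K A ->
    (forall D, finite_set D -> D `<=` p ->
       exists x : M, forall phi, D phi -> sat phi (oapp sval x)) ->
    exists x : M, forall phi, p phi -> sat phi (oapp sval x).

Definition strongly_homogeneous :=
  forall (A : set M) (g : M -> M), small K A -> partial_elementary A g ->
    exists f : M -> M, is_aut f /\ (forall x, A x -> f x = g x).

(* The smallness of the set of L-formulas (in countably many variables)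
   forces |K| to be an uncountable cardinal. *)
Definition monster :=
  [/\ small K [set: formula L nat], saturated & strongly_homogeneous].

End Monster.

Section Isomorphism.
Variables (L : language) (A B : structure L) (h : A -> B).
Hypotheses (hbij : bijective h)
  (hf : forall n (s : func L n) (x : 'I_n -> A), h (fint s x) = fint s (h \o x))
  (hr : forall n (r : predic L n) (x : 'I_n -> A), rint r (h \o x) <-> rint r x).

Lemma iso_eval (V : Type) (v : V -> A) t : eval (h \o v) t = h (eval v t).
Proof.
elim: t => //= n f ts IH; rewrite hf; congr fint; apply/funext => i; exact: IH.
Qed.

Lemma iso_sat (V : Type) (phi : formula L V) (v : V -> A) :
  sat phi (h \o v) <-> sat phi v.
Proof.
have [k hK kK] := hbij.
elim: phi v => {V} [V|V t u|V n p ts|V phi IHp psi IHq|V phi IH] v //=.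
- by rewrite !iso_eval; split=> [/(can_inj hK)|->].
- rewrite -hr; suff -> : (fun i => eval (h \o v) (ts i)) =
            h \o (fun i => eval v (ts i)) by [].
  by apply/funext => i; rewrite iso_eval.
- by rewrite IHp IHq.
- have E x : oapp (h \o v) (h x) = h \o oapp v x by apply/funext; case.
  split=> H x; first by rewrite -IH -E.
  by rewrite -(kK x) E IH.
Qed.

End Isomorphism.

Section Automorphisms.
Variables (L : language) (M : structure L).

Record aut := Aut { aut_fun :> M -> M; autP : is_aut aut_fun }.

Lemma aut_eq (f g : aut) : f =1 g -> f = g.
Proof.
case: f g => [f pf] [g pg] /= /funext fg; move: pf; rewrite fg => pf.
by congr Aut; exact: Prop_irrelevance.
Qed.

Lemma is_aut_id : is_aut (@id M).
Proof. by split=> //; exists id. Qed.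

Lemma is_aut_comp (f g : aut) : is_aut (f \o g).
Proof.
case: f g => [f [fb ff fr]] [g [gb gf gr]] /=; split; first exact: bij_comp.
- by move=> n s x /=; rewrite gf ff.
- by move=> n r x; exact: iff_trans (fr n r (g \o x)) (gr n r x).
Qed.

Lemma is_aut_inv (f : aut) : exists g : aut, cancel f g /\ cancel g f.
Proof.
case: f => [f [[g fK gK] ff fr]] /=.
suff ga : is_aut g by exists (Aut ga).
have E n (x : 'I_n -> M) : f \o (g \o x) = x by apply/funext => i /=; rewrite gK.
split; first by exists f.
- by move=> n s x; apply: (can_inj fK); rewrite gK ff E.
- by move=> n r x; rewrite -fr E.
Qed.

HB.instance Definition _ := gen_eqMixin aut.
HB.instance Definition _ := gen_choiceMixin aut.

Definition aut_one := Aut is_aut_id.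
Definition aut_mul f g := Aut (is_aut_comp f g).
Definition aut_inv f := projT1 (cid (is_aut_inv f)).

Lemma aut_invP (f : aut) : cancel f (aut_inv f) /\ cancel (aut_inv f) f.
Proof. by rewrite /aut_inv; case: cid. Qed.

Lemma aut_mulA : associative aut_mul.
Proof. by move=> f g h; apply: aut_eq. Qed.
Lemma aut_mul1 : left_id aut_one aut_mul.
Proof. by move=> f; apply: aut_eq. Qed.
Lemma aut_mulr1 : right_id aut_one aut_mul.
Proof. by move=> f; apply: aut_eq. Qed.
Lemma aut_mulV : left_inverse aut_one aut_inv aut_mul.
Proof. by move=> f; apply: aut_eq => x; apply: (aut_invP f).1. Qed.
Lemma aut_mulrV : right_inverse aut_one aut_inv aut_mul.
Proof. by move=> f; apply: aut_eq => x; apply: (aut_invP f).2. Qed.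

HB.instance Definition _ := isGroup.Build aut
  aut_mulA aut_mul1 aut_mulr1 aut_mulV aut_mulrV.

Lemma aut_sat (f : aut) (V : Type) (phi : formula L V) (v : V -> M) :
  sat phi (f \o v) <-> sat phi v.
Proof. by case: f => f [fb ff fr]; exact: iso_sat. Qed.

Definition fixes_pointwise (N : set M) (f : aut) := forall x, N x -> f x = x.

Lemma aut_elementary (f : aut) (N : set M) :
  elementary_substructure N -> elementary_substructure (f @` N).
Proof.
case: f => f fa [hN hsat]; have [[g fK gK] ff fr] := fa; rewrite /=.
have gN y : (f @` N) y -> N (g y) by case=> x Nx <-; rewrite fK.
have fN x : N x -> (f @` N) (f x) by exists x.
have hN' : is_substructure (f @` N).
  split; first by have [[x Nx]] := sub_nonempty hN; exists; exists (f x); exact: fN.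
  move=> n s x.
  have := sub_closed hN s (fun i => exist _ _ (gN _ (svalP (x i)))) => /fN /=.
  rewrite ff; suff -> : f \o (fun i => g (sval (x i))) = (fun i => sval (x i)) by [].
  by apply/funext => i /=; rewrite gK.
exists hN' => V phi v.
pose h (x : induced hN) : induced hN' := exist _ _ (fN _ (svalP x)).
pose k (y : induced hN') : induced hN := exist _ _ (gN _ (svalP y)).
have hK : cancel h k by move=> [x Nx]; apply: eq_exist; rewrite /= fK.
have kK : cancel k h by move=> [x Nx]; apply: eq_exist; rewrite /= gK.
have -> : v = h \o (k \o v) by apply/funext => i /=; rewrite kK.
have hf n (s : func L n) (x : 'I_n -> induced hN) :
    h (fint s x) = fint s (h \o x).
  by apply: eq_exist => /=; rewrite ff.
have hr n (r : predic L n) (x : 'I_n -> induced hN) :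
    rint r (h \o x) <-> rint r x.
  exact: fr.
have hb : bijective h by exists k.
rewrite (iso_sat hb hf hr) hsat.
exact: (iff_sym (aut_sat (Aut fa) phi (fun i => sval (k (v i))))).
Qed.

End Automorphisms.

Definition sum_fun (X Y Z : Type) (f : X -> Z) (g : Y -> Z) (u : X + Y) : Z :=
  match u with inl x => f x | inr y => g y end.

(* E(x, y) is defined by a partial type over the empty set, whose variables
   x and y are indexed by the left and the right summand of I + I. *)
Definition type_definable L (M : structure L) (I : Type)
    (E : (I -> M) -> (I -> M) -> Prop) :=
  exists Phi : set (formula L (I + I)), forall x y,
    E x y <-> (forall phi, Phi phi -> sat phi (sum_fun x y)).

(* Tuples may have any length here; statements require eidx to be small. *)
Record tdeqrel L (M : structure L) := TdEqRel {
  eidx : Type;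
  erel :> (eidx -> M) -> (eidx -> M) -> Prop;
  erel_refl : forall x, erel x x;
  erel_sym : forall x y, erel x y -> erel y x;
  erel_trans : forall x y z, erel x y -> erel y z -> erel x z;
  erel_td : type_definable erel
}.

Section Hyperimaginaries.
Variables (L : language) (M : structure L).

Definition eclass (E : tdeqrel M) (x : eidx E -> M) : set (eidx E -> M) :=
  [set y | E x y].

Record hyper (E : tdeqrel M) := Hyper {
  hset : set (eidx E -> M);
  hyperP : exists x, hset = eclass x
}.

Definition hyper_of (E : tdeqrel M) (x : eidx E -> M) : hyper E :=
  Hyper (ex_intro _ x erefl).

Lemma hyper_eq E (X Y : hyper E) : hset X = hset Y -> X = Y.
Proof.
case: X Y => [X pX] [Y pY] /= XY; move: pX; rewrite XY => pX.
by congr Hyper; exact: Prop_irrelevance.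
Qed.

Lemma erel_aut E (f : aut M) (x y : eidx E -> M) : E (f \o x) (f \o y) <-> E x y.
Proof.
have [Phi PhiE] := erel_td E; rewrite !PhiE.
have -> : sum_fun (f \o x) (f \o y) = f \o sum_fun x y by apply/funext; case.
by split=> H phi Pphi; have := H _ Pphi; rewrite aut_sat.
Qed.

Lemma act_eclass E (f : aut M) (x : eidx E -> M) :
  [set f \o y | y in eclass x] = eclass (f \o x).
Proof.
apply/seteqP; split=> [_ [y Exy <-]|y Exy]; first exact/erel_aut.
have [fK gK] := aut_invP f.
have fE : f \o (aut_inv f \o y) = y by apply/funext => i /=; rewrite gK.
by exists (aut_inv f \o y) => //; apply/(erel_aut f); rewrite fE.
Qed.

Lemma act_subproof E (f : aut M) (X : hyper E) :
  exists x, [set f \o y | y in hset X] = eclass x.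
Proof. by have [x ->] := hyperP X; exists (f \o x); exact: act_eclass. Qed.

Definition act E (f : aut M) (X : hyper E) : hyper E := Hyper (act_subproof f X).

Lemma act1 E (X : hyper E) : act 1 X = X.
Proof.
apply: hyper_eq; apply/seteqP; split=> [_ [y Xy <-]//|y Xy]; by exists y.
Qed.

Lemma actM E f g (X : hyper E) : act (f * g) X = act f (act g X).
Proof.
apply: hyper_eq; apply/seteqP; split=> [_ [y Xy <-]|_ [_ [y Xy <-] <-]].
  by exists (g \o y) => //; exists y.
by exists y.
Qed.

Lemma actK E f (X : hyper E) : act f^-1 (act f X) = X.
Proof. by rewrite -actM mulVg act1. Qed.

Lemma actKV E f (X : hyper E) : act f (act f^-1 X) = X.
Proof. by rewrite -actM mulgV act1. Qed.

Section Pairs.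
Variables E F : tdeqrel M.
Let I := (eidx E + eidx F)%type.
Let rel (x y : I -> M) := E (x \o inl) (y \o inl) /\ F (x \o inr) (y \o inr).

Lemma pair_td : type_definable rel.
Proof.
have [P PE] := erel_td E; have [Q QF] := erel_td F.
pose r1 (u : eidx E + eidx E) : I + I := sum_fun (inl \o inl) (inr \o inl) u.
pose r2 (u : eidx F + eidx F) : I + I := sum_fun (inl \o inr) (inr \o inr) u.
exists ((rename r1 @` P) `|` (rename r2 @` Q)) => x y.
have e1 : sum_fun x y \o r1 = sum_fun (x \o inl) (y \o inl)
  by apply/funext; case.
have e2 : sum_fun x y \o r2 = sum_fun (x \o inr) (y \o inr)
  by apply/funext; case.
rewrite /rel PE QF; split.
  by move=> [H1 H2] _ [] [phi Pphi <-]; rewrite sat_rename ?e1 ?e2;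
    [exact: H1|exact: H2].
move=> H; split=> phi Pphi.
  by rewrite -e1 -sat_rename; apply: H; left; exists phi.
by rewrite -e2 -sat_rename; apply: H; right; exists phi.
Qed.

Definition pair_rel : tdeqrel M.
Proof.
apply: (@TdEqRel L M I rel).
- by move=> x; split; exact: erel_refl.
- by move=> x y [xy1 xy2]; split; exact: erel_sym.
- by move=> x y z [xy1 xy2] [yz1 yz2]; split; apply: erel_trans; eassumption.
- exact: pair_td.
Defined.

Lemma hpair_subproof (b : hyper E) (c : hyper F) :
  exists x : eidx pair_rel -> M,
    [set y : eidx pair_rel -> M | hset b (y \o inl) /\ hset c (y \o inr)] =
    eclass x.
Proof.
by have [x ->] := hyperP b; have [y ->] := hyperP c; exists (sum_fun x y).
Qed.

Definition hpair (b : hyper E) (c : hyper F) : hyper pair_rel :=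
  Hyper (hpair_subproof b c).

Lemma act_hpair f b c : act f (hpair b c) = hpair (act f b) (act f c).
Proof.
apply: hyper_eq; apply/seteqP; split=> [_ [y [by_ cy] <-]|y].
  by split; [exists (y \o inl)|exists (y \o inr)].
case=> [[u bu uE] [v cv vE]]; exists (sum_fun u v) => //.
apply/funext; case=> i /=; first exact: (congr1 (fun h => h i) uE).
exact: (congr1 (fun h => h i) vE).
Qed.

Lemma hpair_inj b c b' c' : hpair b c = hpair b' c' -> b = b' /\ c = c'.
Proof.
have ne G (X : hyper G) : exists x, hset X x.
  by have [x ->] := hyperP X; exists x; exact: erel_refl.
move=> /(congr1 (@hset _)) /seteqP [s1 s2].
have [[u bu] [v cv]] := (ne _ b, ne _ c).
have [[u' bu'] [v' cv']] := (ne _ b', ne _ c').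
split; apply: hyper_eq; apply/seteqP; split=> w Hw.
- exact: (s1 (sum_fun w v) (conj Hw cv)).1.
- exact: (s2 (sum_fun w v') (conj Hw cv')).1.
- exact: (s1 (sum_fun u w) (conj bu Hw)).2.
- exact: (s2 (sum_fun u' w) (conj bu' Hw)).2.
Qed.

End Pairs.

Section OverE.
Variables (E : tdeqrel M) (e : hyper E).

(* Aut_e(M), for e a hyperimaginary of sort E *)
Definition AutE : set (aut M) := [set f | act f e = e].

Lemma AutE_subgroup : subgroup AutE.
Proof.
split=> [|f g fe ge|f fe]; rewrite /AutE /= ?act1 //.
  by rewrite actM ge fe.
by rewrite -{1}fe actK.
Qed.

Definition in_dcl (N : set M) := forall f, fixes_pointwise N f -> AutE f.

(* over both b and e *)
Definition conjugates F G (b : hyper F) (c : hyper G) : set (hyper G) :=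
  [set act f c | f in [set f | AutE f /\ act f b = b]].

Definition in_acl F G (c : hyper G) (b : hyper F) :=
  finite_set (conjugates b c).

(* A type is represented by its set of realizations in M, the orbit of d. *)
Definition tp F (d : hyper F) : set (hyper F) := [set act f d | f in AutE].

Definition realization F (d : hyper F) := {x : hyper F | tp d x}.

Lemma tp_act F (d x : hyper F) f : AutE f -> tp d x -> tp d (act f x).
Proof.
move=> fe [g ge <-]; exists (f * g); last by rewrite actM.
by have [_ HM _] := AutE_subgroup; exact: HM.
Qed.

Definition act_tp F (d : hyper F) f (fe : AutE f) (x : realization d) :
    realization d :=
  exist _ (act f (sval x)) (tp_act fe (svalP x)).

(* Aut(q) for q = tp(d/e) *)
Record autq F (d : hyper F) := AutQ {
  autq_fun :> realization d -> realization d;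
  autqP : exists f (fe : AutE f), autq_fun = act_tp fe
}.

Definition restr F (d : hyper F) f (fe : AutE f) : autq d :=
  AutQ (ex_intro _ f (ex_intro _ fe erefl)).

Lemma realization_eq F (d : hyper F) (x y : realization d) :
  sval x = sval y -> x = y.
Proof. by case: x y => [x px] [y py] /= xy; exact: eq_exist. Qed.

Lemma autq_eq F (d : hyper F) (f g : autq d) :
  (forall x, sval (f x) = sval (g x)) -> f = g.
Proof.
case: f g => [f pf] [g pg] /= H.
have fg : f = g by apply/funext => x; exact: realization_eq.
by move: pf; rewrite fg => pf; congr AutQ; exact: Prop_irrelevance.
Qed.

Lemma autq_restr F (d : hyper F) (g : autq d) :
  exists f (fe : AutE f), g = restr d fe.
Proof.
by have [f [fe gE]] := autqP g; exists f, fe; apply: autq_eq => x; rewrite gE.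
Qed.

Section Group.
Variables (F : tdeqrel M) (d : hyper F).
Implicit Types f g : autq d.

HB.instance Definition _ := gen_eqMixin (autq d).
HB.instance Definition _ := gen_choiceMixin (autq d).

Lemma autq_one_subproof :
  exists h (he : AutE h), @id (realization d) = act_tp he.
Proof.
have [e1 _ _] := AutE_subgroup; exists 1, e1.
by apply/funext => x; apply: realization_eq; rewrite /= act1.
Qed.

Lemma autq_mul_subproof f g :
  exists h (he : AutE h), autq_fun f \o g = act_tp he.
Proof.
have [_ eM _] := AutE_subgroup.
have [f' [fe ->]] := autqP f; have [g' [ge ->]] := autqP g.
exists (f' * g'), (eM _ _ fe ge).
by apply/funext => x; apply: realization_eq; rewrite /= actM.
Qed.

Lemma autq_inv_subproof f : exists g : autq d, cancel f g /\ cancel g f.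
Proof.
have [_ _ eV] := AutE_subgroup.
have [f' [fe ->]] := autqP f; exists (restr d (eV _ fe)).
by split=> x; apply: realization_eq; rewrite /= ?actK ?actKV.
Qed.

Definition autq_one : autq d := AutQ autq_one_subproof.
Definition autq_mul f g : autq d := AutQ (autq_mul_subproof f g).
Definition autq_inv f : autq d := projT1 (cid (autq_inv_subproof f)).

Lemma autq_invP f : cancel f (autq_inv f) /\ cancel (autq_inv f) f.
Proof. by rewrite /autq_inv; case: cid. Qed.

Lemma autq_mulA : associative autq_mul.
Proof. by move=> f g h; apply: autq_eq. Qed.
Lemma autq_mul1 : left_id autq_one autq_mul.
Proof. by move=> f; apply: autq_eq. Qed.
Lemma autq_mulr1 : right_id autq_one autq_mul.
Proof. by move=> f; apply: autq_eq. Qed.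
Lemma autq_mulV : left_inverse autq_one autq_inv autq_mul.
Proof. by move=> f; apply: autq_eq => x /=; rewrite (autq_invP f).1. Qed.
Lemma autq_mulrV : right_inverse autq_one autq_inv autq_mul.
Proof. by move=> f; apply: autq_eq => x /=; rewrite (autq_invP f).2. Qed.

HB.instance Definition _ := isGroup.Build (autq d)
  autq_mulA autq_mul1 autq_mulr1 autq_mulV autq_mulrV.

End Group.

Variable K : Type.

Definition Autf : set (aut M) := generated
  [set f | AutE f /\ exists N : set M,
     [/\ small K N, elementary_substructure N, in_dcl N & fixes_pointwise N f]].

Lemma Autf_subgroup : subgroup Autf.
Proof. exact: generated_subgroup. Qed.

Lemma Autf_AutE : Autf `<=` AutE.
Proof. by apply: generated_min; [exact: AutE_subgroup|move=> f []]. Qed.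

Lemma small_image (f : aut M) (N : set M) : small K N -> small K (f @` N).
Proof.
by move=> sN H; apply: sN; apply: card_le_trans H _; exact: card_image_le.
Qed.

Lemma Autf_normal f g : AutE g -> Autf f -> Autf (f ^ g).
Proof.
move=> ge; pose H := [set f | Autf (f ^ g)].
have [A1 AM AV] := Autf_subgroup.
have [_ eM eV] := AutE_subgroup.
suff : Autf `<=` H by apply.
apply: generated_min.
  split=> [|x y Hx Hy|x Hx]; rewrite /H /= ?conj1g ?conjMg ?conjVg //.
    exact: AM.
  exact: AV.
move=> {}f [fe [N [sN NM eN fN]]]; apply: generatedP.
split; first exact: (eM _ _ (eV _ ge) (eM _ _ fe ge)).
have [gK Kg] := aut_invP g.
exists (aut_inv g @` N); split.
- exact: small_image.
- exact: aut_elementary.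
- move=> h hN.
  have : AutE (h ^ g^-1).
    apply: eN => x Nx; rewrite /conjg invgK /=.
    have -> : h (g^-1 x) = g^-1 x by apply: hN; exists x.
    exact: Kg.
  move=> he; rewrite -(conjgKV g h) {1}/conjg.
  exact: (eM _ _ (eV _ ge) (eM _ _ he ge)).
- move=> _ [x Nx <-]; rewrite /conjg /=.
  by rewrite [g _]Kg fN.
Qed.

Definition lascar F (u v : hyper F) := exists2 f, Autf f & act f u = v.

Lemma lascar_refl F (u : hyper F) : lascar u u.
Proof. by have [A1 _ _] := Autf_subgroup; exists 1; rewrite ?act1. Qed.

Lemma lascar_sym F (u v : hyper F) : lascar u v -> lascar v u.
Proof.
have [_ _ AV] := Autf_subgroup.
by case=> f Af <-; exists f^-1; [exact: AV|rewrite actK].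
Qed.

Lemma lascar_trans F (u v w : hyper F) : lascar u v -> lascar v w -> lascar u w.
Proof.
have [_ AM _] := Autf_subgroup.
by case=> f Af <- [g Ag <-]; exists (g * f); [exact: AM|rewrite actM].
Qed.

Lemma lascar_act F (u v : hyper F) g :
  AutE g -> lascar u v -> lascar (act g u) (act g v).
Proof.
have [_ _ eV] := AutE_subgroup.
move=> ge [f Af <-]; exists (f ^ g^-1); first by apply: Autf_normal => //; exact: eV.
by rewrite -actM /conjg invgK -mulgA mulgVK actM.
Qed.

Section Gal.
Variables (F : tdeqrel M) (d : hyper F).

(* Autf^1(q) *)
Definition Autf1_set : set (autq d) :=
  [set f | forall x : realization d, lascar (sval x) (sval (f x))].

Lemma Autf1_subgroup : subgroup Autf1_set.
Proof.
split=> [x|f g Hf Hg x|f Hf x]; first exact: lascar_refl.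
  exact: lascar_trans (Hg x) (Hf (g x)).
have := Hf ((f^-1 : autq d) x); rewrite (autq_invP f).2; exact: lascar_sym.
Qed.

Lemma Autf1_normal f g : Autf1_set f -> Autf1_set (f ^ g).
Proof.
have [_ _ eV] := AutE_subgroup.
move=> Hf x; have [h [he gE]] := autq_restr g.
have -> : (f ^ g) x = (g^-1 : autq d) (f (g x)) by [].
have e1 y : sval (g y) = act h (sval y) by rewrite gE.
have e2 y : sval ((g^-1 : autq d) y) = act h^-1 (sval y).
  by rewrite -{2}((autq_invP g).2 y) e1 actK.
by rewrite e2 -{1}(actK h (sval x)) -e1; apply: lascar_act; [exact: eV|exact: Hf].
Qed.

Definition Autf1 : normalSubgroup (autq d) :=
  NormalSubgroup Autf1_subgroup Autf1_normal.

Definition Gal1 : groupType := quot Autf1.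

(* For f in Aut_e(M), the element (f|q(M)) . Autf^1(q) of Gal^1_L(q). *)
Definition gal1 f (fe : AutE f) : Gal1 := coset Autf1 (restr d fe).

Lemma gal1_surj (x : Gal1) : exists f (fe : AutE f), x = gal1 fe.
Proof.
have [f [fe xE]] := autq_restr (repr x); exists f, fe.
by rewrite /gal1 -xE coset_repr.
Qed.

Lemma gal1P f g (fe : AutE f) (ge : AutE g) :
  gal1 fe = gal1 ge <-> forall x, tp d x -> lascar (act f x) (act g x).
Proof.
have [_ _ eV] := AutE_subgroup.
have Vf (y : realization d) :
    sval (((restr d fe)^-1 : autq d) y) = act f^-1 (sval y).
  by rewrite -{2}((autq_invP (restr d fe)).2 y) /= actK.
rewrite cosetP; split=> [H x dx|H [x dx]] /=.
  have := H (exist _ x dx) => /= /(lascar_act fe).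
  by rewrite Vf /= actKV.
by have := lascar_act (eV _ fe) (H _ dx); rewrite actK Vf.
Qed.

End Gal.

Section Projection.
Variables (F G : tdeqrel M) (b : hyper F) (c : hyper G).

Lemma pi1_subproof (x : Gal1 (hpair b c)) :
  exists y : Gal1 b, exists f (fe : AutE f), x = gal1 _ fe /\ y = gal1 _ fe.
Proof. by have [f [fe xE]] := gal1_surj x; exists (gal1 b fe), f, fe. Qed.

(* The natural projection; by pi1E below it does not depend on the choice. *)
Definition pi1 (x : Gal1 (hpair b c)) : Gal1 b := projT1 (cid (pi1_subproof x)).

Lemma pi1E f (fe : AutE f) : pi1 (gal1 (hpair b c) fe) = gal1 b fe.
Proof.
rewrite /pi1; case: cid => /= _ [g [ge [/gal1P H ->]]].
apply/esym/gal1P => _ [h he <-].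
have {H} [] := H (act h (hpair b c)); first by exists h.
move=> k Ak; rewrite !act_hpair => /hpair_inj[kE _].
by exists k.
Qed.

Lemma pi1M : {morph pi1 : x y / x * y}.
Proof.
have galM H (d : hyper H) f g (fe : AutE f) (ge : AutE g) (fge : AutE (f * g)) :
    gal1 d fe * gal1 d ge = gal1 d fge.
  rewrite /gal1 -cosetM; congr coset; apply: autq_eq => x /=.
  by rewrite actM.
move=> x y; have [f [fe ->]] := gal1_surj x; have [g [ge ->]] := gal1_surj y.
have [_ eM _] := AutE_subgroup.
by rewrite !pi1E !(galM _ _ _ _ _ _ (eM _ _ fe ge)) pi1E.
Qed.

HB.instance Definition _ := isMultiplicative.Build _ _ pi1 pi1M.

Definition K1 : set (Gal1 (hpair b c)) := [set x | pi1 x = 1].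

End Projection.

End OverE.

End Hyperimaginaries.

Arguments pi1 {L M E} e K {F G} b c.
Arguments K1 {L M E} e K {F G} b c.

(* Main.v *)
Require Import Defs.
From mathcomp Require Import all_boot.
From mathcomp Require Import boolp classical_sets functions cardinality.

Local Open Scope classical_set_scope.
Local Open Scope card_scope.

(** Let [D] be the orbit [tp e d].  [Gal1 e K d] acts on the set of Lascar
    classes of [D]; the action is faithful, because [Autf1 e K d] is by
    definition the kernel of the action of [autq e d], and transitive, because
    already [AutE e] is transitive on [D].  A faithful transitive action of an
    abelian group is free, so an element of the group is determined by the
    class to which it sends [d] ([gal1_eq_at]).

    For [d = hpair b c], the kernel [K1 e K b c] is therefore in bijection with
    the orbit of the class of [hpair b c] under it.  This orbit consists of
    the classes that meet the fibre over [b]: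
    - if [f] fixes [b], then, [Gal1 e K (hpair b c)] being abelian, [f] moves
      every realization of [tp e b] within its Lascar class, so that it
      represents an element of the kernel ([fixes_K1]);
    - if [f] represents an element of the kernel, then a Lascar strong
      automorphism brings [act f b] back to [b], and with it the pair
      [act f (hpair b c)] to the fibre, without changing its class
      ([K1_fibre]).
    The classes that meet the fibre are those of the [m0] pairs
    [hpair b (cs i)], and [hpair b (cs i)] is the image of [hpair b c] under
    an automorphism fixing [b], as [cs i] is a conjugate of [c] over [b]
    and [e]. *)

Section RelativizedGaloisGroup.

Set Implicit Arguments.
Unset Strict Implicit.
Local Open Scope group_scope.

Variables (L : language) (M : structure L) (E : tdeqrel M) (e : hyper E).
Variable K : Type.

Lemma lascar_pair (F G : tdeqrel M) (b b' : hyper F) (c c' : hyper G) :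
  lascar e K (hpair b c) (hpair b' c') -> lascar e K b b'.
Proof.
by case=> f Af; rewrite act_hpair => /hpair_inj[fb _]; exists f.
Qed.

Lemma tp_refl (F : tdeqrel M) (d : hyper F) : tp e d d.
Proof. by have [e1 _ _] := AutE_subgroup e; exists 1; rewrite ?act1. Qed.

Lemma gal1M (F : tdeqrel M) (d : hyper F) f g (fe : AutE e f) (ge : AutE e g)
    (fge : AutE e (f * g)) :
  gal1 K d fe * gal1 K d ge = gal1 K d fge.
Proof.
by rewrite /gal1 -cosetM; congr coset; apply: autq_eq => x /=; rewrite actM.
Qed.

(** The form in which commutativity is used: equality of two elements of
    [Gal1 e K d] can be tested pointwise, up to [lascar e K]. *)
Lemma abelian_lascar (F : tdeqrel M) (d x : hyper F) f g :
  abelian_group (Gal1 e K d) -> AutE e f -> AutE e g -> tp e d x ->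
  lascar e K (act f (act g x)) (act g (act f x)).
Proof.
move=> ab fe ge dx; have [_ eM _] := AutE_subgroup e.
have := ab (gal1 K d fe) (gal1 K d ge).
rewrite (gal1M d fe ge (eM _ _ fe ge)) (gal1M d ge fe (eM _ _ ge fe)) => /gal1P.
by move=> /(_ x dx); rewrite !actM.
Qed.

(** An abelian group acts freely when it acts faithfully and transitively: a
    point of the orbit is [act h d], and [h] commutes with [f] and [g]. *)
Lemma gal1_eq_at (F : tdeqrel M) (d : hyper F) f g
    (fe : AutE e f) (ge : AutE e g) :
  abelian_group (Gal1 e K d) -> lascar e K (act f d) (act g d) ->
  gal1 K d fe = gal1 K d ge.
Proof.
move=> ab fg; apply/gal1P => _ [h he <-].
apply: lascar_trans (abelian_lascar ab fe he (tp_refl d)) _.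
apply: lascar_trans (lascar_act he fg) _.
exact: abelian_lascar ab he ge (tp_refl d).
Qed.

Section Kernel.
Variables (F G : tdeqrel M) (b : hyper F) (c : hyper G).

Lemma K1_gal1P f (fe : AutE e f) :
  K1 e K b c (gal1 K (hpair b c) fe) <->
  forall x, tp e b x -> lascar e K x (act f x).
Proof.
rewrite /K1 /= pi1E coset1P; split=> [H x bx|H [x bx]]; last exact: H.
exact: (H (exist _ x bx)).
Qed.

(** Fixing [b] controls [f] at the single realization [b] of [tp e b]; any other
    one is [act h b], and there [f] agrees with [h * f] up to [lascar e K]. *)
Lemma fixes_K1 f (fe : AutE e f) :
  abelian_group (Gal1 e K (hpair b c)) -> act f b = b ->
  K1 e K b c (gal1 K (hpair b c) fe).
Proof.
move=> ab fb; apply/K1_gal1P => _ [h he <-].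
have := abelian_lascar ab he fe (tp_refl _).
by rewrite !act_hpair fb; exact: lascar_pair.
Qed.

(** Correcting [f] by an element of [Autf e K] that undoes the move of [b] does
    not change the Lascar class to which [hpair b c] is sent. *)
Lemma K1_fibre f (fe : AutE e f) :
  K1 e K b c (gal1 K (hpair b c) fe) ->
  exists2 c', tp e (hpair b c) (hpair b c') &
    lascar e K (act f (hpair b c)) (hpair b c').
Proof.
have [_ eM _] := AutE_subgroup e.
move=> /K1_gal1P/(_ b) []; first exact: tp_refl.
move=> k Ak kb; have [_ _ AV] := Autf_subgroup e K.
have kV : Autf e K k^-1 by exact: AV.
exists (act (k^-1 * f) c).
  exists (k^-1 * f); first by apply: eM => //; exact: (Autf_AutE kV).
  by rewrite act_hpair actM -kb actK.
by exists k^-1 => //; rewrite !act_hpair actM -kb actK.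
Qed.

End Kernel.
End RelativizedGaloisGroup.

Theorem proposition5p10 (L : language) (T : theory L) (K : Type)
    (M : structure L)
    (T_complete : complete_theory T) (M_model : is_model T M)
    (M_monster : monster K M)
    (E F G : tdeqrel M)
    (E_small : small K [set: eidx E])
    (F_small : small K [set: eidx F])
    (G_small : small K [set: eidx G])
    (e : hyper E) (b : hyper F) (c : hyper G)
    (c_acl : in_acl e c b)
    (m m0 : nat) (cs : nat -> hyper G)
    (cs_conj : set_bij `I_m (conjugates e b c) cs)
    (cs_0 : cs 0%N = c)
    (m0_gt0 : (0 < m0)%N) (m0_le : (m0 <= m)%N)
    (reps_distinct : forall i j, (i < m0)%N -> (j < m0)%N ->
       lascar e K (hpair b (cs i)) (hpair b (cs j)) -> i = j)
    (reps_all : forall c' : hyper G,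
       tp e (hpair b c) (hpair b c') ->
       exists2 i, (i < m0)%N & lascar e K (hpair b c') (hpair b (cs i))) :
  abelian_group (Gal1 e K (hpair b c)) ->
  K1 e K b c #= `I_m0.
Proof.
move=> ab.
have [cs_sub _ _] := cs_conj.
(* [g i] is the element of the kernel that sends the class of [hpair b c] to
   that of [hpair b (cs i)]; its value at [i >= m0] is arbitrary. *)
have /choice[g gP] : forall i, exists x : Gal1 e K (hpair b c), (i < m0)%N ->
    exists f (fe : AutE e f), [/\ x = gal1 K (hpair b c) fe, act f b = b &
      act f (hpair b c) = hpair b (cs i)].
  move=> i; case: (ltnP i m0) => [im0|_]; last by exists 1%g.
  have [f [fe fb] fc] := cs_sub i (leq_trans im0 m0_le).
  by exists (gal1 K (hpair b c) fe) => _; exists f, fe; rewrite act_hpair fb fc.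
suff /Pbij[h _] : set_bij `I_m0 (K1 e K b c) g.
  by rewrite card_eq_sym; exact: pcard_eq h.
split=> [i im0|i j|x].
- by have [f [fe [-> fb _]]] := gP i im0; exact: fixes_K1.
- rewrite !inE => im0 jm0.
  have [f [fe [-> _ fi]]] := gP i im0; have [h [he [-> _ hj]]] := gP j jm0.
  move=> /gal1P/(_ _ (tp_refl _ _)).
  by rewrite fi hj; exact: reps_distinct.
- have [f [fe ->]] := gal1_surj x => /K1_fibre[c' bc' fc'].
  have [i im0 ci] := reps_all _ bc'.
  have [h [he [gE _ hi]]] := gP i im0.
  exists i => //; rewrite gE; apply: gal1_eq_at => //; rewrite hi.
  exact/lascar_sym/(lascar_trans fc' ci).
Qed.
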